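(* (Directed Robinson Crusoe theorem) Let $(X,T,G)$ be a topological dynamical system, where $G$ is an infinite group with a proper right-invariant distance $d$. Let $G_0\subseteq G$ be an unbounded subset with an unbounded complement $G\setminus G_0$. Assume that - $O\subsetneq X$ is an open, not closed, $G$-invariant subset of $X$; - the set $O$ is not pointwise $\tilde S$-repulsed by its border for some finite subset $\tilde S\subseteq\bigcap_{H\in\mathcal{H}_{\partial G_0}}H$. Then, for any neighborhood $U$ of the border $\partial O$, there exists a horofunction $j\in\partial[G\setminus G_0^{-1}]$ such that its associated horoball $H=\{x\in G:j(x)<0\}\in\mathcal{H}_{\partial[G\setminus G_0^{-1}]}$ satisfies $$O\cap\bigcap_{g\in H}T_g^{-1}(U)\neq\emptyset.$$
   Context: $G$ is a second countable, locally compact topological group with identity $1_G$, and $d$ is a metric on $G$ inducing its topology which is right-invariant ($d(gf,hf)=d(g,h)$) and proper (closed balls are compact). Write $B_R(g)=\{h\in G: d(h,g)<R\}$. For $g\in G$ let $b_g\colon G\to\mathbb{R}$, $b_g(x)=d(g,x)-d(g,1_G)$. A sequence $(g_n)$ in $G$ goes to infinity if for every $m$, $g_n\notin B_m(1_G)$ for all large enough $n$. For an unbounded set $A\subseteq G$, $\partial A$ denotes the set of functions $j\colon G\to\mathbb{R}$ that are limits, uniformly on compact sets, of $(b_{g_n})$ for some sequence $(g_n)$ in $A$ going to infinity; elements of $\partial G$ are called horofunctions. $\mathcal{H}_{\partial A}$ is the set of horoballs $\{x\in G:j(x)<0\}$ with $j\in\partial A$ (possibly empty sets). For $A\subseteq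 G$, $A^{-1}=\{a^{-1}:a\in A\}$. A topological dynamical system $(X,T,G)$ is a continuous left action $T\colon G\times X\to X$ of $G$ on a compact metric space $X$ with distance $\operatorname{dist}$; $T_g=T(g,\cdot)$ and $T_g\circ T_h=T_{gh}$. A set $O\subseteq X$ is $G$-invariant if $T_g(O)=O$ for all $g\in G$; $\partial O$ is its topological boundary. For $S\subseteq G$, $\langle S\rangle_+$ is the semigroup of elements $s_1\cdots s_n$ with each $s_i\in S\cup\{1_G\}$. An open $G$-invariant set $O$ is pointwise $S$-repulsed by its border if there exists $\delta>0$ such that for any finite set $F\subseteq O$ one has $\operatorname{dist}(T_gF,\partial O)\le\delta$ for at most finitely many $g\in\langle S\rangle_+$ (here $\operatorname{dist}$ between sets is the infimum of distances between their points). Otherwise $O$ is not pointwise $S$-repulsed by its border. *)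

(* Defs.v *)
From HB Require Import structures.
From mathcomp Require Import all_boot all_order all_algebra.
From mathcomp Require Import all_classical all_reals all_analysis.

Set Implicit Arguments.
Unset Strict Implicit.
Unset Printing Implicit Defensive.

Import Order.TTheory GRing.Theory Num.Theory.
Import numFieldNormedType.Exports.

Local Open Scope classical_set_scope.
Local Open Scope ring_scope.

(* Multiplicative, possibly infinite and non-commutative topological groups. *)
HB.mixin Record isTopologicalGroup G & Topological G & Group G := {
  mulg_continuous : continuous (fun p : G * G => (p.1 * p.2)%g);
  invg_continuous : continuous (fun g : G => (g^-1)%g)
}.

#[short(type="topologicalGroupType")]
HB.structure Definition TopologicalGroup :=
  {G of Topological G & Group G & isTopologicalGroup G}.

(* A topological group together with a distance [mdist] inducing its topology;
   no compatibility between the distance and the group law is imposed here. *)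
#[short(type="metricGroupType")]
HB.structure Definition MetricGroup (R : numDomainType) :=
  {G of TopologicalGroup G & Metric R G}.

Section metric_group.
Context {R : realType} {G : metricGroupType R}.
Implicit Types (A S : set G) (j : G -> R) (u : nat -> G).

Definition unbounded A : Prop := forall m : nat, ~ A `<=` ball (1%g : G) m%:R.

Definition goes_to_infinity u : Prop :=
  forall m : nat, \forall n \near \oo, ~ ball (1%g : G) m%:R (u n).

Definition busemann (g x : G) : R := mdist g x - mdist g 1%g.

Definition horofunctions A : set (G -> R) :=
  [set j | exists u, [/\ forall n, A (u n), goes_to_infinity u
                       & {family compact, busemann \o u @ \oo --> j}]].

Definition horoball j : set G := [set x | j x < 0].

Definition horoballs A : set (set G) := horoball @` horofunctions A.

(* Words are allowed to be empty: the empty product 1 is also the value of the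
   one-letter word 1, so this does not change the set. *)
Definition generated_semigroup S : set G :=
  [set \big[*%g/1%g]_(s <- w) s
    | w in [set w : seq G | forall s, s \in w -> (S `|` [set 1%g]) s]].

End metric_group.

Definition right_invariant_metric (R : realType) (G : metricGroupType R) :=
  forall f g h : G, mdist (g * f)%g (h * f)%g = mdist g h.

(* The library's [closed_ball] is the closure of the open ball, hence the
   explicit set here. *)
Definition proper_metric (R : realType) (M : metricType R) :=
  forall (x : M) (r : R), compact [set y | mdist y x <= r].

Definition boundary (X : topologicalType) (A : set X) : set X :=
  closure A `\` interior A.

(* Extended-real valued, so that the distance to the empty set is +oo. *)
Definition set_dist (R : realType) (X : metricType R) (A B : set X) : \bar R :=
  ereal_inf [set (mdist x y)%:E | x in A & y in B].

Section dynamics.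
Context {R : realType} {G : metricGroupType R} {X : metricType R}.
Implicit Types (T : G -> X -> X) (S : set G) (O : set X).

Definition dynamical_system T : Prop :=
  [/\ compact [set: X],
      continuous (fun p : G * X => T p.1 p.2),
      forall x, T 1%g x = x
    & forall g h, T g \o T h = T (g * h)%g].

Definition invariant_set T O : Prop := forall g, T g @` O = O.

Definition pointwise_repulsed T S O : Prop :=
  exists2 delta : R, 0 < delta &
    forall F : set X, finite_set F -> F `<=` O ->
      finite_set (generated_semigroup S `&`
        [set g | (set_dist (T g @` F) (boundary O) <= delta%:E)%E]).

End dynamics.

(* Main.v *)
Require Import Defs.
From mathcomp Require Import all_boot all_order all_algebra.
From mathcomp Require Import all_classical all_reals all_analysis.
From mathcomp Require Import lra.

Import Order.TTheory GRing.Theory Num.Theory.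
Import numFieldNormedType.Exports.

Set Implicit Arguments.
Unset Strict Implicit.
Unset Printing Implicit Defensive.

Local Open Scope classical_set_scope.
Local Open Scope ring_scope.

(** Let [V] be an open neighbourhood of the border with closure inside [U]. What
    remains of the closure of [O] outside [V] is a compact subset [K] of [O]. For
    [x] in [O], call [h] a visit of [x] when [T h x] lies in [K]; at all other
    times the orbit of [x] lies in [V]. A point without visits stays in [V]
    forever and settles the matter with any horofunction; suppose there is none.

    Take a time [g] and a visit [k] nearest to [g]. Right translation by the
    inverse of [k] moves the ball about [g] that is free of visits to a ball
    about [a = g * k^-1] with [1] on its boundary, so the point [y = T k x] of
    [K] satisfies [T h y] in [V] for all [h] with [busemann a h < 0]. If such
    pairs [(y, a)] exist with [a^-1] outside [G0] and [a] arbitrarily far, then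
    the functions [busemann a] accumulate at a horofunction [j] (Arzela-Ascoli),
    the points [y] accumulate in [K], and the limit point stays in the closure of
    [V] at all times of the horoball of [j]: lemma [horoball_limit].

    Otherwise [k * g^-1] belongs to [G0] whenever [k] is a far nearest visit of
    [g]. As [S] lies in every horoball of [G0], the value of
    [busemann (k * g^-1)] at each [s] in [S] is then below a negative constant,
    uniformly (lemma [finite_busemann_horoballs]); by right invariance this says
    that [k] is closer to [s * g] than to [g] by at least that constant. Hence the
    distance to the visits decreases along words in [S] until it falls under a
    bound independent of [x] (lemma [word_approaches]), so that all but finitely
    many elements of the semigroup send [x] into a fixed compact subset of [O].
    This is the repulsion excluded by hypothesis: lemma
    [uniform_returns_repulsed]. *)

(** * Metric spaces *)

Section metric_facts.
Context {R : realType} {M : metricType R}.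
Implicit Types x y z : M.

Lemma mdist_continuous : continuous (fun p : M * M => mdist p.1 p.2).
Proof.
move=> [x y]; apply/cvgrPdist_lt => e e0.
have e2 : 0 < e / 2 by rewrite divr_gt0.
exists (ball x (e / 2), ball y (e / 2)) => /=.
  by split; exact: nbhsx_ballx.
move=> [x' y'] [/=]; rewrite !ballEmdist /= => xx' yy'.
rewrite ltr_norml.
have := metric_triangle x x' y; have := metric_triangle x' y' y.
have := metric_triangle x' x y'; have := metric_triangle x y y'.
rewrite (metric_sym y' y) (metric_sym x' x); lra.
Qed.

Lemma mdistl_continuous x : continuous (mdist x).
Proof.
move=> y; apply: (@continuous_comp _ _ _ (fun y : M => (x, y))
  (fun p : M * M => mdist p.1 p.2)); last exact: mdist_continuous.
by apply: cvg_pair => //=; exact: cvg_cst.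
Qed.

Lemma compact_separation (K L : set M) :
  compact K -> compact L -> K `&` L = set0 ->
  exists2 e : R, 0 < e & forall x y, K x -> L y -> e <= mdist x y.
Proof.
move=> cK cL KL0; have [[p KLp]|KL] := pselect (K `*` L !=set0); last first.
  by exists 1 => // x y Kx Ly; exfalso; apply: KL; exists (x, y).
have [] := @compact_EVT_min _ R (fun p : M * M => mdist p.1 p.2) (K `*` L).
- by exists p.
- exact: compact_setX.
- by apply: continuous_subspaceT; exact: mdist_continuous.
move=> [x y] /set_mem[/= Kx Ly] xymin.
exists (mdist x y); last first.
  by move=> x' y' Kx' Ly'; have := xymin (x', y'); apply; apply/mem_set.
rewrite mdist_gt0; apply/eqP => xy.
have : (K `&` L) x by split=> //; rewrite xy.
by rewrite KL0.
Qed.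

Lemma proper_nearest_point (A : set M) x :
  proper_metric M -> closed A -> A !=set0 ->
  exists2 y, A y & forall z, A z -> mdist x y <= mdist x z.
Proof.
move=> properM clA [a Aa].
have [] := @compact_EVT_min _ R (mdist x) ([set y | mdist y x <= mdist a x] `&` A).
- by exists a; split => //=.
- by apply: compact_closedI => //; exact: properM.
- by apply: continuous_subspaceT; exact: mdistl_continuous.
move=> y /set_mem[/= yx Ay] ymin; exists y => // z Az.
have [zx|zx] := leP (mdist z x) (mdist a x).
  by apply: ymin; apply/mem_set.
by rewrite metric_sym (le_trans yx)// (metric_sym x) ltW.
Qed.

End metric_facts.

(** * Compactness of horofunctions *)

Section horofunction_facts.
Context {R : realType} {G : metricGroupType R}.
Implicit Types (u : nat -> G) (g x y : G) (j : G -> R).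

Lemma busemann1 g : busemann g 1%g = 0.
Proof. exact: subrr. Qed.

Lemma busemann_lipschitz g x y : `|busemann g x - busemann g y| <= mdist x y.
Proof.
rewrite /busemann ler_norml.
have := metric_triangle g x y; have := metric_triangle g y x.
rewrite (metric_sym y x); lra.
Qed.

Lemma busemann_equicontinuous :
  equicontinuous (range (@busemann R G)) id.
Proof.
move=> x E; rewrite -entourage_ballE => -[e /= e0 eE].
near=> y; move=> _ [g _ <-] /=; apply: eE => /=.
rewrite /ball/= (le_lt_trans (busemann_lipschitz g x y))//.
near: y; have := nbhsx_ballx x e e0; rewrite ballEmdist.
exact: filterS.
Unshelve. all: by end_near. Qed.

Lemma busemann_pointwise_precompact :
  pointwise_precompact (range (@busemann R G)) id.
Proof.
move=> x; pose I := [set` `[- mdist x 1%g, mdist x 1%g]%R].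
apply: (@precompact_subset _ _ I).
  move=> _ [_ [g _ <-] <-]; rewrite /I /= in_itv /= -ler_norml.
  by have := busemann_lipschitz g x 1%g; rewrite busemann1 subr0.
rewrite precompact_closed; first exact: segment_compact.
exact: interval_closed.
Qed.

Lemma family_compact_nbhs j (K : set G) (e : R) : compact K -> 0 < e ->
  nbhs (j : {family compact, G -> R}) [set h | forall x, K x -> `|j x - h x| < e].
Proof.
move=> cK e0.
have /fam_cvgP/(_ K cK) : {family compact, nbhs (j : {family compact, G -> R}) --> j}.
  exact: cvg_id.
apply; apply/uniform_nbhs; exists [set xy | ball xy.1 e xy.2]; split => //=.
by rewrite -entourage_ballE; exists e.
Qed.

(** Arzela-Ascoli provides a cluster point [j] of the sequence in the topology of
    compact convergence. Properness makes the closed balls about [1] a countable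
    exhaustion by compact sets, so choosing [phi m] with an error below
    [1 / (m + 1)] on the ball of radius [m] turns [j] into a limit. The condition
    [m <= phi m] is what keeps [u \o phi] going to infinity when [u] does. *)
Lemma horofunction_subsequence u : proper_metric G ->
  exists (phi : nat -> nat) j, (forall m, (m <= phi m)%N) /\
    {family compact, busemann \o (u \o phi) @ \oo --> j}.
Proof.
move=> properG.
pose W := range (@busemann R G) : set {family compact, G -> R}.
have : precompact W.
  apply: pointwise_precompact_equicontinuous.
  - exact: Rhausdorff.
  - exact: busemann_pointwise_precompact.
  - exact: busemann_equicontinuous.
rewrite precompactE => cW.
pose F := (busemann \o u @ \oo : set_system {family compact, G -> R}).
have [j [_ jF]] : closure W `&` cluster F !=set0.
  apply: cW; apply: filterS (@subset_closure _ W) _.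
  by exists 0%N => // n _; exists (u n).
have step (m : nat) : exists n, (m <= n)%N /\
    forall x, mdist x 1%g <= m%:R -> `|j x - busemann (u n) x| < m.+1%:R^-1.
  have [||h [[n mn <-]] hj] := jF [set busemann (u n) | n in [set n | (m <= n)%N]]
    [set h | forall x, mdist x 1%g <= m%:R -> `|j x - h x| < m.+1%:R^-1].
  - by exists m => // n mn; exists n.
  - by apply: family_compact_nbhs; [exact: properG|rewrite invr_gt0].
  - by exists n.
have [phi phiP] := choice step.
exists phi, j; split=> [m|]; first by case: (phiP m).
apply/fam_cvgP => K cK P /uniform_nbhs[E [entE EP]].
move: entE; rewrite -entourage_ballE => -[e /= e0 eE].
have [r Kr] : exists r : R, forall x, K x -> mdist x 1%g <= r.
  have [K0|K0] := pselect (K !=set0); last first.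
    by exists 0 => x Kx; exfalso; apply: K0; exists x.
  have [|c _ cmax] := @compact_EVT_max _ R (mdist 1%g) K K0 cK.
    by apply: continuous_subspaceT; exact: mdistl_continuous.
  by exists (mdist 1%g c) => x Kx; rewrite metric_sym; apply/cmax/mem_set.
near=> m; apply: EP => x Kx; apply: eE => /=.
have [_ /(_ x) xm] := phiP m; rewrite /ball/= (lt_trans (xm _))//.
  apply: (le_trans (Kr x Kx)); near: m; exact: nbhs_infty_ger.
near: m; exact: near_infty_natSinv_lt (PosNum e0).
Unshelve. all: by end_near. Qed.

Lemma horofunction_limit (A : set G) u : proper_metric G ->
  (forall n, A (u n)) -> (forall n, n%:R <= mdist 1%g (u n)) ->
  exists (phi : nat -> nat) j, [/\ horofunctions A j, forall m, (m <= phi m)%N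
    & forall x, busemann (u (phi m)) x @[m --> \oo] --> j x].
Proof.
move=> properG Au ub.
have [phi [j [phim phij]]] := horofunction_subsequence u properG.
exists phi, j; split=> // [|x].
  exists (u \o phi); split=> // [n|m]; first exact: Au.
  exists m => // n /= mn; rewrite ballEmdist /=; apply/negP; rewrite -leNgt.
  by rewrite (le_trans _ (ub _))// ler_nat (leq_trans mn).
apply/cvgrPdist_lt => e e0.
apply: (phij [set h | `|j x - h x| < e]).
by apply: filterS (family_compact_nbhs j (@compact_set1 _ x) e0) => h; exact.
Qed.

(** If [busemann a s] were close to [0] for arbitrarily far [a] in [A], a
    horofunction of [A] would be nonnegative at [s]. *)
Lemma busemann_horoball (A : set G) (s : G) : proper_metric G ->
  (\bigcap_(H in horoballs A) H) s ->
  exists N, forall a, A a -> N%:R <= mdist 1%g a -> busemann a s <= - N.+1%:R^-1.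
Proof.
move=> properG As; apply: contrapT => noN.
have /choice[u uP] : forall N, exists a,
    [/\ A a, N%:R <= mdist 1%g a & - N.+1%:R^-1 < busemann a s].
  move=> N; apply: contrapT => noa; apply: noN; exists N => a Aa Na.
  by rewrite leNgt; apply/negP => sa; apply: noa; exists a.
have [|n|phi [j [Aj phim phij]]] := @horofunction_limit A u properG.
- by move=> n; case: (uP n).
- by case: (uP n).
have : horoball j s by apply: As; exists j.
rewrite /horoball /=; apply/negP; rewrite -leNgt.
have harm0 : - (m.+1%:R^-1 : R) @[m --> \oo] --> (0 : R).
  by rewrite -oppr0; apply: cvgN; exact: cvg_harmonic.
apply: ler_cvg_to harm0 (phij s) _.
apply: nearW => m; have [_ _ /ltW/(le_trans _)] := uP (phi m); apply.
by rewrite lerN2 lef_pV2 ?posrE// ler_nat ltnS.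
Qed.

Lemma finite_busemann_horoballs (A S : set G) : proper_metric G ->
  finite_set S -> S `<=` \bigcap_(H in horoballs A) H ->
  exists N, forall a, A a -> N%:R <= mdist 1%g a ->
    forall s, S s -> busemann a s <= - N.+1%:R^-1.
Proof.
move=> properG /finite_seqP[w ->].
elim: w => [|s w IH] Sw; first by exists 0%N.
have [|N1 N1P] := IH; first by move=> t tw; apply: Sw; rewrite /= inE tw orbT.
have [|N2 N2P] := @busemann_horoball A s properG.
  by apply: Sw; rewrite /= inE eqxx.
have mono N N' : (N <= N')%N -> - N.+1%:R^-1 <= - N'.+1%:R^-1 :> R.
  by move=> NN'; rewrite lerN2 lef_pV2 ?posrE// ler_nat ltnS.
exists (maxn N1 N2) => a Aa aN t /=; rewrite inE => /orP[/eqP ->|tw].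
  apply: (le_trans _ (mono _ _ (leq_maxr N1 N2))); apply: N2P => //.
  by rewrite (le_trans _ aN)// ler_nat leq_maxr.
apply: (le_trans _ (mono _ _ (leq_maxl N1 N2))); apply: N1P => //.
by rewrite (le_trans _ aN)// ler_nat leq_maxl.
Qed.

End horofunction_facts.

(** * Words and the distance to a set of times *)

Section return_times.
Context {R : realType} {G : metricGroupType R}.
Implicit Types (S A : set G) (g h k s : G) (w : seq G).

Lemma mdist_div g k : right_invariant_metric G ->
  mdist 1%g (k * g^-1)%g = mdist g k.
Proof. by move=> invG; rewrite -(invG g 1%g) mul1g mulgVK. Qed.

(** Letters equal to [1] are dropped: word length then controls how often a
    generator acts, which is what [word_approaches] counts. *)
Lemma generated_semigroup_word S g : generated_semigroup S g ->
  exists2 w, (forall s, s \in w -> S s) & g = \big[*%g/1%g]_(s <- w) s.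
Proof.
move=> [w wS <-]; exists [seq s <- w | s != 1%g].
  by move=> s; rewrite mem_filter => /andP[/eqP s1 /wS[]].
rewrite big_filter [RHS]big_mkcond/=; apply: eq_bigr => s _.
by case: eqVneq.
Qed.

Lemma finite_words S n : finite_set S ->
  finite_set [set \big[*%g/1%g]_(s <- w) s |
    w in [set w | (forall s, s \in w -> S s) /\ (size w <= n)%N]].
Proof.
move=> finS; elim: n => [|n IH].
  apply: (sub_finite_set _ (finite_set1 1%g)) => _ [[|s w] [_ wn] <-] //.
  by rewrite big_nil.
have finSn := finite_image2 (fun g h => (g * h)%g) finS IH.
have : finite_set ([set 1%g] `|` [set (g * h)%g | g in S & h in
    [set \big[*%g/1%g]_(s <- w) s |
      w in [set w | (forall s, s \in w -> S s) /\ (size w <= n)%N]]]).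
  by rewrite finite_setU; split=> //; exact: finite_set1.
apply: sub_finite_set.
move=> _ [[|s w] [wS wn] <-]; first by left; rewrite big_nil.
right => /=; exists s; first by apply: wS; rewrite inE eqxx.
exists (\big[*%g/1%g]_(t <- w) t); rewrite ?big_cons//.
exists w => //=; split; last exact: wn.
by move=> t tw; apply: wS; rewrite inE tw orbT.
Qed.

(** Reading [w] from the right, each letter [s] in [S] moves the current time [g]
    to [s * g]. While [g] is at distance at least [L] from [A] this brings it
    closer to [A] by [c]; once it is within [L], a letter moves it away by at most
    [M], and beyond [L] it only comes closer again. *)
Lemma word_approaches S A (L M c : R) k0 w :
  right_invariant_metric G -> proper_metric G -> closed A ->
  A k0 -> 0 <= c -> (forall s, S s -> mdist 1%g s <= M) ->
  (forall g k, A k -> (forall h, A h -> mdist g k <= mdist g h) ->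
     L <= mdist g k -> forall s, S s -> busemann (k * g^-1)%g s <= - c) ->
  (forall s, s \in w -> S s) ->
  exists2 k, A k &
    mdist (\big[*%g/1%g]_(s <- w) s) k <= L + M \/
    mdist (\big[*%g/1%g]_(s <- w) s) k + c *+ size w <= mdist 1%g k0.
Proof.
move=> invG properG clA Ak0 c0 SM step; elim: w => [_|s w IH wS].
  by exists k0 => //; right; rewrite big_nil mulr0n addr0.
have Ss : S s by apply: wS; rewrite inE eqxx.
have [|k' Ak' k'P] := IH; first by move=> t tw; apply: wS; rewrite inE tw orbT.
rewrite big_cons /= mulrS; set g := \big[_/_]_(_ <- _) _ in k'P *.
have [|k Ak kmin] := @proper_nearest_point R G A g properG clA; first by exists k'.
exists k => //.
have kk' := kmin _ Ak'.
have [Lk|kL] := leP L (mdist g k); last first.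
  left; have := metric_triangle (s * g)%g g k.
  have : mdist (s * g)%g g = mdist 1%g s by rewrite -{2}(mul1g g) invG metric_sym.
  have := SM _ Ss; lra.
(* Right translation by [g] turns [busemann (k * g^-1) s] into
   [mdist k (s * g) - mdist k g]. *)
have := step g k Ak kmin Lk s Ss; rewrite /busemann.
rewrite -(invG g _ s) mulgVK (metric_sym _ 1%g) (mdist_div _ _ invG).
rewrite (metric_sym k); case: k'P => k'P; [left|right]; lra.
Qed.

End return_times.

(** * Topology *)

Lemma closed_boundary (X : topologicalType) (B : set X) : closed (boundary B).
Proof.
by apply: closedI; [exact: closed_closure|exact/open_closedC/open_interior].
Qed.

Lemma compact_shrink_nbhs (X : topologicalType) (B U : set X) :
  hausdorff_space X -> compact [set: X] -> closed B -> set_nbhs B U ->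
  exists V, [/\ open V, B `<=` V & closure V `<=` U].
Proof.
move=> hX cX clB /(compact_normal hX cX clB)[W BW WU].
exists (interior W); split; [exact: open_interior|by []|].
by apply: subset_trans WU; apply: closureS; exact: interior_subset.
Qed.

(** * Dynamics near the border *)

Section dynamics.
Context {R : realType} {G : metricGroupType R} {X : metricType R}.
Context (T : G -> X -> X) (sysT : dynamical_system T).

Lemma dynamical_system_continuous g : continuous (T g).
Proof.
case: sysT => _ contT _ _ x.
apply: (@continuous_comp _ _ _ (fun x : X => (g, x)) (fun p : G * X => T p.1 p.2)).
  by apply: cvg_pair => //=; exact: cvg_cst.
exact: contT.
Qed.

Lemma orbit_continuous x : continuous (T^~ x).
Proof.
case: sysT => _ contT _ _ g.
apply: (@continuous_comp _ _ _ (fun g : G => (g, x)) (fun p : G * X => T p.1 p.2)).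
  by apply: cvg_pair => //=; exact: cvg_cst.
exact: contT.
Qed.

Lemma dynamical_systemM g h x : T (g * h)%g x = T g (T h x).
Proof. by case: sysT => _ _ _ TM; rewrite -TM. Qed.

Lemma invariant_set_mem (O : set X) g x : invariant_set T O -> O x -> O (T g x).
Proof. by move=> invO Ox; rewrite -(invO g); exists x. Qed.

(** A time [g] in the horoball of the limit [j] is eventually in the horoballs of
    the approximations, because [j g < 0] is an open condition on [j]; the base
    points are then followed by continuity of [T g]. *)
Lemma horoball_limit (A : set G) (K V : set X) :
  proper_metric G -> compact K ->
  (forall n : nat, exists y a, [/\ K y, A a, n%:R <= mdist 1%g a
     & forall g, busemann a g < 0 -> V (T g y)]) ->
  exists2 j, horofunctions A j &
    K `&` \bigcap_(g in horoball j) (T g @^-1` closure V) !=set0.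
Proof.
move=> properG cK /choice[y] /choice[a yaP].
have [n|n|phi [j [Aj phim phij]]] := @horofunction_limit _ _ A a properG.
- by case: (yaP n).
- by case: (yaP n).
have [z [Kz zcl]] : K `&` cluster (y \o phi @ \oo) !=set0.
  by apply: cK; exists 0%N => // n _; case: (yaP (phi n)).
exists j => //; exists z; split => // g jg B TgB.
have jg' : \forall m \near \oo, busemann (a (phi m)) g < 0.
  exact: (cvgr_lt _ (phij g)).
have [] := zcl [set y (phi m) | m in [set m | busemann (a (phi m)) g < 0]]
               (T g @^-1` B).
- by apply: filterS jg' => m mg; exists m.
- exact: dynamical_system_continuous.
move=> _ [[m mg <-] BT]; exists (T g (y (phi m))); split => //.
by have [_ _ _] := yaP (phi m); apply.
Qed.

(** Long words in [S] bring every orbit within time [L + M] of a visit to [K],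
    hence into the compact set [C] of points reached from [K] in bounded time.
    Invariance keeps [C] inside [O], and half its distance to the border is the
    repulsion constant. *)
Lemma uniform_returns_repulsed (S : set G) (O K : set X) (L c : R) :
  right_invariant_metric G -> proper_metric G ->
  open O -> invariant_set T O -> compact K -> K `<=` O ->
  finite_set S -> 0 < c ->
  (forall x, O x -> exists h, K (T h x)) ->
  (forall x g k, O x -> K (T k x) ->
     (forall h, K (T h x) -> mdist g k <= mdist g h) -> L <= mdist g k ->
     forall s, S s -> busemann (k * g^-1)%g s <= - c) ->
  pointwise_repulsed T S O.
Proof.
move=> invG properG openO invO cK KO finS c0 visits step.
have [cX contT _ _] := sysT.
have [M SM] : exists M, forall s, S s -> mdist 1%g s <= M.
  have /finite_seqP[w ->] := finS.
  exists (\big[Num.max/0]_(s <- w) mdist 1%g s) => s sw.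
  exact: le_bigmax_seq.
pose C := (fun p : G * X => T p.1 p.2) @` ([set g | mdist g 1%g <= L + M] `*` K).
have cC : compact C.
  apply: continuous_compact; first exact: continuous_subspaceT.
  by apply: compact_setX => //; exact: properG.
have C_bd : C `&` boundary O = set0.
  rewrite -subset0 => _ [[[g y] [_ /= Ky] <-]] [_]; apply => /=.
  by have/interior_id -> := openO; apply: invariant_set_mem invO _; exact: KO.
have cbd : compact (boundary O).
  by apply: (subclosed_compact _ cX) => //; exact: closed_boundary.
have [e e0 eC] := compact_separation cC cbd C_bd.
exists (e / 2); first by rewrite divr_gt0.
move=> F finF FO.
pose bad x := generated_semigroup S `&` [set g | ~ C (T g x)].
apply: (@sub_finite_set _ _ (\bigcup_(x in F) bad x)).
  move=> g [Sg /= gF].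
  have /ereal_inf_lt[_ /= [_ [x Fx <-] [z bz <-]]] :
      (set_dist (T g @` F) (boundary O) < e%:E)%E.
    by rewrite (le_lt_trans gF)// lte_fin ltr_pdivrMr// ltr_pMr// ltr1n.
  rewrite lte_fin => xze; exists x => //; split=> // Cx.
  by have := eC _ _ Cx bz; rewrite leNgt xze.
apply: bigcup_finite => // x Fx; have Ox := FO x Fx.
have [k0 Kk0] := visits x Ox.
(* The descent by [c] at each letter exhausts the initial distance to a visit
   after [N] letters. *)
pose N := Num.bound (mdist 1%g k0 / c).
apply: sub_finite_set (finite_words N finS) => g [Sg Cg].
have [w wS gw] := generated_semigroup_word Sg.
exists w => //; split=> //.
have clA : closed [set h | K (T h x)].
  apply: (preimage_closed (f := T^~ x));
    first by move=> h _; exact: orbit_continuous.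
  exact: compact_closed (@metric_hausdorff _ _) cK.
have [k /= Kk []] := @word_approaches R G S [set h | K (T h x)] L M c k0 w
    invG properG clA Kk0 (ltW c0) SM (fun g k => step x g k Ox) wS.
  rewrite -gw => gk; exfalso; apply: Cg.
  exists ((g * k^-1)%g, T k x) => /=; last by rewrite -dynamical_systemM mulgVK.
  by split=> //=; rewrite metric_sym mdist_div// metric_sym.
rewrite -gw => gk; rewrite ltnW//.
rewrite -(ltr_nat R); apply: (@le_lt_trans _ _ (mdist 1%g k0 / c)).
  rewrite ler_pdivlMr// mulrC -mulr_natr in gk *.
  by have := mdist_ge0 g k; move: gk; lra.
have := archi_boundP (divr_ge0 (mdist_ge0 1%g k0) (ltW c0)); exact.
Qed.

End dynamics.

(** * The directed Robinson Crusoe theorem *)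

Theorem theorem3p4 (R : realType) (G : metricGroupType R) (X : metricType R)
  (T : G -> X -> X) (G0 : set G) (O : set X)
  (G_second_countable : @second_countable G)
  (G_locally_compact : locally_compact [set: G])
  (G_right_invariant : right_invariant_metric G)
  (G_proper : proper_metric G)
  (G_infinite : infinite_set [set: G])
  (T_system : dynamical_system T)
  (G0_unbounded : unbounded G0)
  (G0C_unbounded : unbounded (~` G0))
  (O_proper : O `<` [set: X])
  (O_open : open O)
  (O_not_closed : ~ closed O)
  (O_invariant : invariant_set T O)
  (O_not_repulsed : exists S : set G,
     [/\ finite_set S,
         S `<=` \bigcap_(H in horoballs G0) H
       & ~ pointwise_repulsed T S O])
  (U : set X)
  (U_nbhs : set_nbhs (boundary O) U) :
  exists2 j : G -> R,
    horofunctions (~` [set (a^-1)%g | a in G0]) j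
    & O `&` \bigcap_(g in horoball j) (T g @^-1` U) !=set0.
Proof.
have [S [finS SH nrep]] := O_not_repulsed.
have [cX _ _ _] := T_system.
pose A := ~` [set (a^-1)%g | a in G0].
have AE g : A g <-> ~ G0 (g^-1)%g.
  split=> [Ag G0g|G0g [a G0a ag]]; last by apply: G0g; rewrite -ag invgK.
  by apply: Ag; exists (g^-1)%g => //; rewrite invgK.
have [V [openV bdV VU]] :=
  compact_shrink_nbhs (@metric_hausdorff _ X) cX (@closed_boundary _ O) U_nbhs.
pose K := closure O `\` V.
have cK : compact K.
  apply: (subclosed_compact _ cX) => //.
  by apply: closedI; [exact: closed_closure|exact: open_closedC].
have KO : K `<=` O.
  move=> x [clx Vx]; apply: contrapT => Ox; apply: Vx; apply: bdV; split => //.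
  by move=> /interior_subset.
have OKV x : O x -> ~ K x -> V x.
  move=> Ox nKx; apply: contrapT => nVx; apply: nKx; split => //.
  exact: subset_closure.
(* The base points range over [K] in the main case, but over a single orbit's
   point when that orbit never visits [K]. *)
suff [K' [cK' K'O K'P]] : exists K' : set X, [/\ compact K', K' `<=` O &
    forall n : nat, exists y a, [/\ K' y, A a, n%:R <= mdist 1%g a
      & forall g, busemann a g < 0 -> V (T g y)]].
  have [j Aj [y [K'y jy]]] := horoball_limit T_system G_proper cK' K'P.
  by exists j => //; exists y; split; [exact: K'O|move=> g /jy /VU].
apply: contrapT => noK'.
(* An orbit without visits stays in [V] forever, so any far times will do. *)
have visits x : O x -> exists h, K (T h x).
  move=> Ox; apply: contrapT => nvis; apply: noK'; exists [set x]; split.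
  - exact: compact_set1.
  - by move=> _ ->.
  - move=> n; have /existsNP[a /not_implyP[G0a an]] := G0C_unbounded n.
    exists x, (a^-1)%g; split => //; first by apply/AE; rewrite invgK.
      rewrite -(mul1g (a^-1)%g) mdist_div// metric_sym.
      by move: an; rewrite ballEmdist/= => /negP; rewrite -leNgt.
    move=> g _; apply: OKV; first exact: invariant_set_mem O_invariant Ox.
    by move=> Kg; apply: nvis; exists g.
have [n0 n0P] : exists n0 : nat, forall y a, K y -> n0%:R <= mdist 1%g a ->
    (forall g, busemann a g < 0 -> V (T g y)) -> ~ A a.
  apply: contrapT => non0; apply: noK'; exists K; split=> // n.
  apply: contrapT => nya; apply: non0; exists n => y a Ky na Vy Aa.
  by apply: nya; exists y, a.
have [N NP] := finite_busemann_horoballs G_proper finS SH.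
apply: nrep; apply: (@uniform_returns_repulsed _ _ _ _ T_system S O K
  (maxn n0 N)%:R N.+1%:R^-1) => //.
move=> x g k Ox Kk kmin kL s Ss.
have kL1 : n0%:R <= mdist g k by rewrite (le_trans _ kL)// ler_nat leq_maxl.
have kL2 : N%:R <= mdist g k by rewrite (le_trans _ kL)// ler_nat leq_maxr.
apply: NP => //; last by rewrite mdist_div.
(* [T k x] is a point of [K] whose orbit is in [V] on the horoball of
   [busemann (g * k^-1)], which is the visit-free ball about [g] translated. *)
have : ~ A (g * k^-1)%g.
  apply: (n0P (T k x)) => //; first by rewrite mdist_div// metric_sym.
  move=> h; rewrite /busemann subr_lt0 -(G_right_invariant k _ h) mulgVK.
  rewrite (metric_sym _ 1%g) mdist_div// (metric_sym k) => gh.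
  rewrite -(dynamical_systemM T_system); apply: OKV.
    exact: invariant_set_mem O_invariant Ox.
  by move=> /kmin; rewrite leNgt gh.
move=> nA; apply: contrapT => nG0; apply: nA; apply/AE.
by rewrite invgM invgK.
Qed.
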